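(* Let $\Delta$ be a connected poset with countable fundamental group $\Pi:=\pi_1(\Delta)$ (given the discrete topology) and let $G$ be a locally compact group. Then assigning to each bundle $C^*$-gerbe $\check{\mathcal A}$ over $\Delta$ its twisted holonomy $\mathcal A_*=(A_a,\alpha_a,\bar\jmath^{\,a},\gamma_* )$, and to each untwisted gerbe morphism $\eta$ the *-morphism $\eta_*:=\eta_a$, defines a functor $$\mathbf{C^*grb}^u_{\Delta,G}\ \to\ \mathbf{tC^*dyn}_{\Pi,G}.$$
   Context: **Posets.** $\Sigma_0(\Delta)=\Delta$; for $n\ge1$ an $n$-simplex $d\in\Sigma_n(\Delta)$ is a tuple $(\partial_0d,\dots,\partial_nd;|d|)$ with $\partial_kd\in\Sigma_{n-1}(\Delta)$, $|d|\in\Delta$, $|\partial_kd|\le|d|$ (with $|o|=o$ for $o\in\Delta$) and $\partial_{hk}d=\partial_{k\,h+1}d$ for $h\ge k$, $\partial_{hk}:=\partial_h\circ\partial_k$. A 1-simplex $b=(\partial_0b,\partial_1b;|b|)$ goes from $\partial_1b$ to $\partial_0b$; $\iota_a=(a,a;a)$. $N_1(\Delta)\subset\Sigma_1(\Delta)$ is the set of $b$ with $\partial_1b\le\partial_0b=|b|$; $N_2(\Delta)\subset\Sigma_2(\Delta)$ consists of the simplices attached to chains $o\le\omega\le\xi$: $\partial_2c=(o\le\omega)$, $\partial_0c=(\omega\le\xi)$, $\partial_1c=(o\le\xi)$, $|c|=\xi$. A path $p=b_n*\dots*b_1:a\to o$ is a sequence of 1-simplices with $\partial_1b_1=a$, $\partial_0b_k=\partial_1b_{k+1}$,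 $\partial_0b_n=o$. Homotopy of paths is the equivalence relation generated by replacing $\partial_1c$ with $\partial_0c*\partial_2c$ (or conversely), $c\in\Sigma_2(\Delta)$; $\pi_1^a(\Delta)\simeq\pi_1(\Delta)$ is the group of homotopy classes of loops $a\to a$, with identity $[\iota_a]$. **2-groups and cocycles.** A 2-group ${}^2G=(G\to N)$ is a pair of group morphisms $i:G\to N$, $g\mapsto\underline g$, and $N\to\mathrm{Aut}\,G$, $u\mapsto\widehat u$, with $i(\widehat u(g))=ui(g)u^{-1}$ and $\widehat{i(g)}(h)=ghg^{-1}$. $\check Z^2(\Delta,{}^2G)$ is the set of pairs $q=(u,g)$, $u:\Sigma_1(\Delta)\to N$, $g:\Sigma_2(\Delta)\to G$, with $\underline{g_c}=u_{\partial_0c}u_{\partial_2c}u_{\partial_1c}^{-1}$ for $c\in\Sigma_2(\Delta)$ and $g_{\partial_0d}g_{\partial_2d}=\widehat u_{\partial_{01}d}(g_{\partial_3d})g_{\partial_1d}$ for $d\in\Sigma_3(\Delta)$. **$C^*$-gerbes.** A bundle $C^*$-gerbe $\check{\mathcal A}=(A,\jmath)_\Delta$ (for some $q=(u,g)\in\check Z^2(\Delta,(G\to N))$) consists of $C^*$-algebras $A_o$ with pointwise continuous actions $\alpha_o:G\to\mathrm{Aut}\,A_o$, $o\in\Delta$, and *-isomorphisms $\jmath_b:A_{\partial_1b}\to A_{\partial_0b}$, $b\in N_1(\Delta)$, with $\alpha_{\partial_{01}c}(g_c)\circ\jmath_{\partial_1c}=\jmath_{\partial_0c}\circ\jmath_{\partial_2c}$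 for $c\in N_2(\Delta)$ and $\jmath_b\circ\alpha_{\partial_1b}(g)=\alpha_{\partial_0b}(\widehat u_b(g))\circ\jmath_b$ for $g\in G$. One sets $\jmath_b:=\jmath_{|b|\partial_0b}^{-1}\circ\jmath_{|b|\partial_1b}$ for $b\in\Sigma_1(\Delta)$ and $\jmath_p:=\jmath_{b_n}\circ\dots\circ\jmath_{b_1}$ for a path $p$. $\mathbf{C^*grb}^u_{\Delta,G}$ has these as objects ($G$ fixed, $N$ and $q$ arbitrary); arrows $\eta:\check{\mathcal A}\to\check{\mathcal A}'$ are families of *-morphisms $\eta_o:A_o\to A'_o$ with $\eta_{\partial_0b}\circ\jmath_b=\jmath'_b\circ\eta_{\partial_1b}$ and $\alpha'_o(g)\circ\eta_o=\eta_o\circ\alpha_o(g)$. **Twisted systems.** For an action $\alpha:G\to\mathrm{Aut}\,A$ let $N_\alpha A$ be the normalizer of $\alpha(G)$ in $\mathrm{Aut}\,A$ ($\mathrm{Aut}\,A$ has the pointwise convergence topology). A twisted $C^*$-dynamical system over $G,\Pi$ is $(A,\alpha,\nu,\gamma)$ with Borel maps $\nu:\Pi\to N_\alpha A$, $\gamma:\Pi\times\Pi\to G$ with $\nu_1=\mathrm{id}$, $\nu_l\circ\nu_m=\alpha_{\gamma(l,m)}\circ\nu_{lm}$. $\mathbf{tC^*dyn}_{\Pi,G}$ has these as objects; arrows are *-morphisms $\eta:A\to A'$ with $\eta\circ\nu_l=\nu'_l\circ\eta$ and $\eta\circ\alpha_g=\alpha'_g\circ\eta$. **Twisted holonomy.**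 Fix $a\in\Delta$, a map $s$ choosing for each $l\in\pi_1^a(\Delta)$ a loop $s(l):a\to a$ of class $l$ with $s(1)=\iota_a$, and for each $\check{\mathcal A}$ a section $\varsigma_{\check{\mathcal A},a}:\alpha_a(G)\to G$ of $\alpha_a$. Then $\bar\jmath^{\,a}_l:=\jmath_{s(l)}\in\mathrm{Aut}\,A_a$, $\gamma^a(l,m):=\bar\jmath^{\,a}_l\circ\bar\jmath^{\,a}_m\circ(\bar\jmath^{\,a}_{lm})^{-1}\in\alpha_a(G)$, $\gamma_*(l,m):=\varsigma_{\check{\mathcal A},a}(\gamma^a(l,m))$. *)

(* Defs.v *)
From HB Require Import structures.
From mathcomp Require Import all_boot all_order all_algebra.
From mathcomp Require Import generic_quotient complex.
From mathcomp Require Import all_classical all_reals all_analysis.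
From Stdlib Require Import Relations.

Set Implicit Arguments.
Unset Strict Implicit.
Unset Printing Implicit Defensive.

Import Order.TTheory GRing.Theory Num.Theory numFieldNormedType.Exports.

Local Open Scope classical_set_scope.
Local Open Scope ring_scope.
Local Open Scope quotient_scope.

HB.mixin Record isTopologicalGroup G & Group G & Topological G := {
  mulg_continuous : continuous (fun x : G * G => (x.1 * x.2)%g : G);
  invg_continuous : continuous (fun x : G => x^-1%g : G)
}.

#[short(type="topGroupType")]
HB.structure Definition TopologicalGroup :=
  {G of isTopologicalGroup G & Group G & Topological G}.

Definition borel_map (X Y : topologicalType) (f : X -> Y) : Prop :=
  forall B : set Y, <<s @open Y >> B -> <<s @open X >> (f @^-1` B).

(* Units are not required, whence the multiplication is not that of a
   MathComp ring. The norm takes its values in the nonnegative reals of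
   [R[i]]. *)
HB.mixin Record isCstarAlgebra (R : realType) A
    & CompleteNormedModule R[i] A := {
  cmul : A -> A -> A;
  cstar : A -> A;
  cmulA : associative cmul;
  cmulDl : left_distributive cmul +%R;
  cmulDr : right_distributive cmul +%R;
  cmulZl : forall (c : R[i]) (x y : A), cmul (c *: x) y = c *: cmul x y;
  cmulZr : forall (c : R[i]) (x y : A), cmul x (c *: y) = c *: cmul x y;
  cstarK : involutive cstar;
  cstarD : {morph cstar : x y / x + y};
  cstarZ : forall (c : R[i]) (x : A), cstar (c *: x) = c^* *: cstar x;
  cstarM : forall x y : A, cstar (cmul x y) = cmul (cstar y) (cstar x);
  cnormM : forall x y : A, `|cmul x y| <= `|x| * `|y|;
  cnorm_star : forall x : A, `|cmul (cstar x) x| = `|x| ^+ 2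
}.

#[short(type="cstarAlgType")]
HB.structure Definition CstarAlgebra (R : realType) :=
  {A of isCstarAlgebra R A & CompleteNormedModule R[i] A}.

Section StarMorphisms.
Variable R : realType.
Implicit Types A B C : cstarAlgType R.

Record star_hom A B := StarHom {
  star_fun :> A -> B;
  star_homL : linear star_fun;
  star_homM : {morph star_fun : x y / cmul x y};
  star_homS : {morph star_fun : x / cstar x}
}.

HB.instance Definition _ A B (f : star_hom A B) :=
  GRing.isLinear.Build R[i] A B *:%R (star_fun f) (star_homL f).

Lemma star_hom_ext A B (f g : star_hom A B) : f =1 g -> f = g.
Proof.
case: f g => [f fL fM fS] [g gL gM gS] /= /funext fg.
by subst g; congr StarHom; exact: Prop_irrelevance.
Qed.

Definition star_id A : star_hom A A :=
  @StarHom A A id (fun _ _ _ => erefl) (fun _ _ => erefl) (fun _ => erefl).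

Lemma star_comp_linear A B C (g : star_hom B C) (f : star_hom A B) :
  linear (g \o f).
Proof. by move=> c x y /=; rewrite !linearP. Qed.

Lemma star_compM A B C (g : star_hom B C) (f : star_hom A B) :
  {morph g \o f : x y / cmul x y}.
Proof. by move=> x y /=; rewrite !star_homM. Qed.

Lemma star_compS A B C (g : star_hom B C) (f : star_hom A B) :
  {morph g \o f : x / cstar x}.
Proof. by move=> x /=; rewrite !star_homS. Qed.

Definition star_comp A B C (g : star_hom B C) (f : star_hom A B) :
    star_hom A C :=
  StarHom (star_comp_linear g f) (star_compM g f) (star_compS g f).

Record star_iso A B := StarIso {
  iso_fun :> star_hom A B;
  iso_inv : star_hom B A;
  isoK : cancel iso_fun iso_inv;
  isoVK : cancel iso_inv iso_fun
}.

Lemma star_iso_ext A B (f g : star_iso A B) : f =1 g -> f = g.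
Proof.
case: f g => [f f' fK f'K] [g g' gK g'K] /= fg.
have e : f = g by exact: star_hom_ext.
subst g.
have e' : f' = g' by apply: star_hom_ext => x; rewrite -{1}(g'K x) fK.
by subst g'; congr StarIso; exact: Prop_irrelevance.
Qed.

Definition iso_id A : star_iso A A :=
  @StarIso A A (star_id A) (star_id A) (fun _ => erefl) (fun _ => erefl).

Definition iso_sym A B (f : star_iso A B) : star_iso B A :=
  StarIso (@isoVK _ _ f) (@isoK _ _ f).

Definition iso_comp A B C (g : star_iso B C) (f : star_iso A B) :
    star_iso A C :=
  @StarIso A C (star_comp g f) (star_comp (iso_inv f) (iso_inv g))
    (can_comp (@isoK _ _ g) (@isoK _ _ f))
    (can_comp (@isoVK _ _ f) (@isoVK _ _ g)).

Definition Aut A := star_iso A A.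

HB.instance Definition _ A := gen_eqMixin (Aut A).
HB.instance Definition _ A := gen_choiceMixin (Aut A).
HB.instance Definition _ A := Topological.copy (Aut A)
  (initial_topology (fun f : Aut A => (f : A -> A) : {ptws A -> A})).

Record action (G : topGroupType) A := Action {
  act :> G -> Aut A;
  actM : forall (g h : G) x, act (g * h)%g x = act g (act h x);
  act_continuous : forall x : A, continuous (fun g => act g x)
}.

Definition normalizer (G : topGroupType) A (alpha : action G A) :
    set (Aut A) :=
  [set f | [set iso_comp (iso_comp f (alpha g)) (iso_sym f) | g in [set: G]]
           = range alpha].

End StarMorphisms.

Section Simplices.
Context {disp : Order.disp_t} (D : porderType disp).

Fixpoint presimplex (n : nat) : choiceType :=
  if n is m.+1 then (m.+2.-tuple (presimplex m) * D)%type : choiceType else D.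

Definition presupp n : presimplex n -> D :=
  match n with 0 => id | m.+1 => fun d => d.2 end.

Definition preface n (d : presimplex n.+1) (k : 'I_n.+2) : presimplex n :=
  tnth d.1 k.

(* For [h, k <= m + 1] with [k <= h]: the [h]-th face of the [k]-th face of
   [d] is the [k]-th face of its [(h + 1)]-st face. *)
Definition preface_identities n : presimplex n.+1 -> bool :=
  match n with
  | 0 => fun _ => true
  | m.+1 => fun d => [forall h : 'I_m.+2, forall k : 'I_m.+2, (k <= h)%N ==>
      (preface (preface d (widen_ord (leqnSn _) k)) h
       == preface (preface d (lift ord0 h)) k)]
  end.

Fixpoint is_simplex (n : nat) : presimplex n -> bool :=
  match n with
  | 0 => fun _ => true
  | m.+1 => fun d => [&& [forall k, is_simplex (preface d k)],
      [forall k, (presupp (preface d k) <= presupp d)%O]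
      & preface_identities d]
  end.

Definition simplex (n : nat) : choiceType :=
  if n is m.+1 then {d : presimplex m.+1 | is_simplex d} : choiceType else D.

Definition simplex_val n : simplex n -> presimplex n :=
  match n with 0 => id | m.+1 => fun d => val d end.

Definition supp n (d : simplex n) : D := presupp (simplex_val d).

Lemma preface_simplex n (d : presimplex n.+1) k :
  is_simplex d -> is_simplex (preface d k).
Proof. by case/and3P=> /forallP/(_ k). Qed.

Definition face n : simplex n.+1 -> forall k, (k < n.+2)%N -> simplex n :=
  match n with
  | 0 => fun d k kn => preface (val d) (Ordinal kn)
  | m.+1 => fun d k kn => exist _ (preface (val d) (Ordinal kn))
                            (preface_simplex (Ordinal kn) (valP d))
  end.

End Simplices.

Arguments simplex : simpl never.
Arguments face : simpl never.

Notation "'d_[ k ] x" := (@face _ _ _ x k isT)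
  (at level 8, k at level 0, x at level 8, format "''d_[' k ]  x").

Section SimplexTheory.
Context {disp : Order.disp_t} {D : porderType disp}.

Lemma supp_face n (d : simplex D n.+1) k (kn : (k < n.+2)%N) :
  (supp (face d kn) <= supp d)%O.
Proof.
case: n d kn => [|n] [d dP] kn; case/and3P: (dP) => _;
by move=> /forallP/(_ (Ordinal kn)).
Qed.

Lemma supp_face1 (b : simplex D 1) k (kn : (k < 2)%N) :
  (face b kn <= supp b)%O.
Proof. exact: (supp_face b kn). Qed.

Lemma face_face n (d : simplex D n.+2) h k (kh : (k <= h)%N)
    (k3 : (k < n.+3)%N) (h2 : (h < n.+2)%N)
    (h3 : (h.+1 < n.+3)%N) (k2 : (k < n.+2)%N) :
  face (face d k3) h2 = face (face d h3) k2.
Proof.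
have E : preface (preface (val d) (Ordinal k3)) (Ordinal h2)
       = preface (preface (val d) (Ordinal h3)) (Ordinal k2).
  case/and3P: (valP d) => _ _.
  move=> /forallP/(_ (Ordinal h2))/forallP/(_ (Ordinal k2))/implyP/(_ kh)/eqP.
  by congr (preface (preface _ _) _ = preface (preface _ _) _); exact: val_inj.
by case: n d k3 h2 h3 k2 E => [|n] d k3 h2 h3 k2 E //; exact: val_inj.
Qed.

Lemma face00 (c : simplex D 2) : 'd_[0] ('d_[0] c) = 'd_[0] ('d_[1] c).
Proof. exact: face_face. Qed.

Lemma face10 (c : simplex D 2) : 'd_[1] ('d_[0] c) = 'd_[0] ('d_[2] c).
Proof. exact: face_face. Qed.

Lemma face11 (c : simplex D 2) : 'd_[1] ('d_[1] c) = 'd_[1] ('d_[2] c).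
Proof. exact: face_face. Qed.

Lemma simplex1_subproof (y x s : D) : (y <= s)%O -> (x <= s)%O ->
  @is_simplex _ D 1 ([tuple y; x], s).
Proof.
move=> ys xs; rewrite /= andbT; apply/andP; split; apply/forallP => //.
by case; case=> [|[|//]] /= i.
Qed.

Definition simplex1 (y x s : D) (ys : (y <= s)%O) (xs : (x <= s)%O) :
  simplex D 1 := exist _ ([tuple y; x], s) (simplex1_subproof ys xs).

Lemma simplex1_ext (b b' : simplex D 1) : 'd_[0] b = 'd_[0] b' ->
  'd_[1] b = 'd_[1] b' -> supp b = supp b' -> b = b'.
Proof.
case: b b' => [[b s] bP] [[b' s'] b'P] /= e0 e1 es; apply: val_inj => /=.
rewrite /supp /= in es; rewrite es; congr pair.
apply: eq_from_tnth => -[[|[|//]] i].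
  by rewrite (bool_irrelevance i isT).
by rewrite (bool_irrelevance i isT).
Qed.

Lemma simplex2_subproof (b0 b1 b2 : simplex D 1) (s : D) :
  (supp b0 <= s)%O -> (supp b1 <= s)%O -> (supp b2 <= s)%O ->
  'd_[0] b0 = 'd_[0] b1 -> 'd_[1] b0 = 'd_[0] b2 -> 'd_[1] b1 = 'd_[1] b2 ->
  @is_simplex _ D 2 ([tuple val b0; val b1; val b2], s).
Proof.
move=> h0 h1 h2 e00 e10 e11; apply/and3P; split.
- apply/forallP => -[[|[|[|//]]] i].
  + exact: (valP b0).
  + exact: (valP b1).
  + exact: (valP b2).
- by apply/forallP => -[[|[|[|//]]] i].
apply/forallP => -[[|[|//]] hi]; apply/forallP => -[[|[|//]] ki];
  apply/implyP => // _; apply/eqP.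
- by rewrite (bool_irrelevance hi isT) (bool_irrelevance ki isT).
- by rewrite (bool_irrelevance hi isT) (bool_irrelevance ki isT).
- by rewrite (bool_irrelevance hi isT) (bool_irrelevance ki isT).
Qed.

Definition simplex2 (b0 b1 b2 : simplex D 1) (s : D)
    (h0 : (supp b0 <= s)%O) (h1 : (supp b1 <= s)%O) (h2 : (supp b2 <= s)%O)
    (e00 : 'd_[0] b0 = 'd_[0] b1) (e10 : 'd_[1] b0 = 'd_[0] b2)
    (e11 : 'd_[1] b1 = 'd_[1] b2) : simplex D 2 :=
  exist _ ([tuple val b0; val b1; val b2], s)
    (simplex2_subproof h0 h1 h2 e00 e10 e11).

Lemma simplex2_faces b0 b1 b2 s h0 h1 h2 e00 e10 e11 :
  let c := @simplex2 b0 b1 b2 s h0 h1 h2 e00 e10 e11 in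
  [/\ 'd_[0] c = b0, 'd_[1] c = b1, 'd_[2] c = b2 & supp c = s].
Proof. by split=> //; exact: val_inj. Qed.

Definition iota1 (a : D) : simplex D 1 := simplex1 (lexx a) (lexx a).

Definition N1 (b : simplex D 1) : bool :=
  ('d_[1] b <= 'd_[0] b)%O && ('d_[0] b == supp b).

(* The element of [N1] attached to [o <= w]; by [N1P] these are all of [N1]. *)
Definition nerve1 (o w : D) (ow : (o <= w)%O) : simplex D 1 :=
  simplex1 (lexx w) ow.

Lemma N1P b :
  reflect (exists o w (ow : (o <= w)%O), b = nerve1 ow) (N1 b).
Proof.
apply: (iffP idP) => [/andP[b10 /eqP bs]|[x [w [xw ->]]]].
  by exists ('d_[1] b), ('d_[0] b), b10; exact: simplex1_ext.
by apply/andP; split; [exact: xw|exact/eqP].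
Qed.

Definition nerve2 (o w x : D) (ow : (o <= w)%O) (wx : (w <= x)%O) :
    simplex D 2 :=
  @simplex2 (nerve1 wx) (nerve1 (le_trans ow wx)) (nerve1 ow) x
    (lexx x) (lexx x) wx erefl erefl erefl.

End SimplexTheory.

Section Homotopy.
Context {disp : Order.disp_t} {D : porderType disp}.
Implicit Types (a o x : D) (p q r : seq (simplex D 1)).

Fixpoint is_walk a o p : bool :=
  if p is b :: p' then ('d_[1] b == a) && is_walk ('d_[0] b) o p' else a == o.

(* The path [b_n * ... * b_1] is the sequence [:: b_1; ...; b_n], so that the
   product of paths is the concatenation in the opposite order. *)
Definition poset_path a o := {p | (p != [::]) && is_walk a o p}.

Definition connected_poset := forall a o, inhabited (poset_path a o).

Variant deformation : seq (simplex D 1) -> seq (simplex D 1) -> Prop :=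
  Deformation p (c : simplex D 2) q :
    deformation (p ++ 'd_[1] c :: q) (p ++ [:: 'd_[2] c, 'd_[0] c & q]).

Definition homotopic a o : relation (poset_path a o) :=
  clos_refl_sym_trans _ (fun u v => deformation (val u) (val v)).

Lemma is_walk_cat a o p q :
  is_walk a o (p ++ q) <-> exists x, is_walk a x p /\ is_walk x o q.
Proof.
elim: p a => [|b p IH] a /=.
  by split=> [h|[x [/eqP->]]//]; exists a.
split=> [/andP[ba /IH[x [px xq]]]|[x [/andP[ba px] xq]]].
  by exists x; rewrite ba.
by rewrite ba; apply/IH; exists x.
Qed.

Lemma deformation_walk a o p q : deformation p q ->
  is_walk a o p = is_walk a o q.
Proof.
case=> {}p c {}q; elim: p a => [|b p IH] a /=; last by rewrite IH.
by rewrite face00 face10 face11 eqxx.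
Qed.

Lemma deformation_nil p q : deformation p q -> (p != [::]) = (q != [::]).
Proof. by case=> -[]. Qed.

Let shom := clos_refl_sym_trans _ deformation.

Lemma shom_catl r p q : shom p q -> shom (r ++ p) (r ++ q).
Proof.
elim=> {p q} [_ _ [p c q]|p|p q _|p q s _ + _]; last exact: rst_trans.
- by rewrite !catA; apply: rst_step; exact: Deformation.
- exact: rst_refl.
- exact: rst_sym.
Qed.

Lemma shom_catr r p q : shom p q -> shom (p ++ r) (q ++ r).
Proof.
elim=> {p q} [_ _ [p c q]|p|p q _|p q s _ + _]; last exact: rst_trans.
- by rewrite -!catA !cat_cons; apply: rst_step; exact: Deformation.
- exact: rst_refl.
- exact: rst_sym.
Qed.

Lemma shom_path p q a o : shom p q ->
  (p != [::]) && is_walk a o p = (q != [::]) && is_walk a o q.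
Proof.
elim=> {p q} // [p q pq|p q s _ -> _ ->//].
by rewrite (deformation_walk _ _ pq) (deformation_nil pq).
Qed.

Lemma homotopicP a o (p q : poset_path a o) :
  homotopic p q <-> shom (val p) (val q).
Proof.
split.
  elim=> {p q} [p q|p|p q _|p q s _ + _]; last exact: rst_trans.
  - exact: rst_step.
  - exact: rst_refl.
  - exact: rst_sym.
move eu: (val p) => u; move ev: (val q) => v uv.
elim: uv p q eu ev => {u v} [u v uv|u|u v _ IH|u v w uv IH1 _ IH2] p q.
- by move=> pu qv; apply: rst_step; rewrite pu qv.
- by move=> pu qu; rewrite (val_inj (etrans pu (esym qu))); exact: rst_refl.
- by move=> pu qv; apply: rst_sym; exact: IH.
move=> pu qw; have vP : (v != [::]) && is_walk a o v.
  by rewrite -(shom_path a o uv) -pu (valP p).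
by apply: (rst_trans _ _ _ (exist _ v vP)); [exact: IH1|exact: IH2].
Qed.

Lemma path_cat_subproof a x o (q : poset_path x o) (p : poset_path a x) :
  (val p ++ val q != [::]) && is_walk a o (val p ++ val q).
Proof.
case: p q => [p /= /andP[p0 pP]] [q /= /andP[q0 qP]]; apply/andP; split.
  by case: p p0 {pP}.
by apply/is_walk_cat; exists x.
Qed.

Definition path_mul a x o (q : poset_path x o) (p : poset_path a x) :
  poset_path a o := exist _ (val p ++ val q) (path_cat_subproof q p).

Lemma path1_subproof a : ([:: iota1 a] != [::]) && is_walk a a [:: iota1 a].
Proof. by rewrite /= !eqxx. Qed.

Definition path_one a : poset_path a a := exist _ [:: iota1 a] (path1_subproof a).

Definition rev1 (b : simplex D 1) : simplex D 1 :=
  simplex1 (supp_face1 b (isT : (1 < 2)%N)) (supp_face1 b (isT : (0 < 2)%N)).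

Lemma path_inv_subproof a o (p : poset_path a o) :
  (map rev1 (rev (val p)) != [::]) && is_walk o a (map rev1 (rev (val p))).
Proof.
case: p => p /= /andP[p0 pP]; apply/andP; split.
  by case: p p0 {pP} => // b p _; rewrite rev_cons map_rcons; case: map.
elim: p a pP {p0} => [|b p IH] a /=; first by rewrite eq_sym.
move=> /andP[/eqP <- /IH h]; rewrite rev_cons map_rcons -cats1.
by apply/is_walk_cat; exists ('d_[0] b); rewrite /= !eqxx.
Qed.

Definition path_inv a o (p : poset_path a o) : poset_path o a :=
  exist _ (map rev1 (rev (val p))) (path_inv_subproof p).

Lemma shom_iotar (b : simplex D 1) : shom [:: b; iota1 ('d_[0] b)] [:: b].
Proof.
pose c := @simplex2 _ _ (iota1 ('d_[0] b)) b b (supp b) (supp_face1 _ _)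
  (lexx _) (lexx _) erefl erefl erefl.
have [c0 c1 c2 _] : [/\ 'd_[0] c = iota1 ('d_[0] b), 'd_[1] c = b,
  'd_[2] c = b & supp c = supp b] by exact: simplex2_faces.
apply: rst_sym; have := Deformation [::] c [::]; rewrite c0 c1 c2.
exact: rst_step.
Qed.

Lemma shom_iotal (b : simplex D 1) : shom [:: iota1 ('d_[1] b); b] [:: b].
Proof.
pose c := @simplex2 _ _ b b (iota1 ('d_[1] b)) (supp b) (lexx _) (lexx _)
  (supp_face1 _ _) erefl erefl erefl.
have [c0 c1 c2 _] : [/\ 'd_[0] c = b, 'd_[1] c = b,
  'd_[2] c = iota1 ('d_[1] b) & supp c = supp b] by exact: simplex2_faces.
apply: rst_sym; have := Deformation [::] c [::]; rewrite c0 c1 c2.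
exact: rst_step.
Qed.

Lemma shom_rev (b : simplex D 1) :
  shom [:: b; rev1 b] [:: iota1 ('d_[1] b)].
Proof.
pose c := @simplex2 _ _ (rev1 b) (iota1 ('d_[1] b)) b (supp b) (lexx _)
  (supp_face1 _ _) (lexx _) erefl erefl erefl.
have [c0 c1 c2 _] : [/\ 'd_[0] c = rev1 b, 'd_[1] c = iota1 ('d_[1] b),
  'd_[2] c = b & supp c = supp b] by exact: simplex2_faces.
apply: rst_sym; have := Deformation [::] c [::]; rewrite c0 c1 c2.
exact: rst_step.
Qed.

Lemma rev1K : involutive rev1.
Proof. by move=> b; exact: simplex1_ext. Qed.

Lemma shom_cat_iota a o p : p != [::] -> is_walk a o p ->
  shom (p ++ [:: iota1 o]) p.
Proof.
elim/last_ind: p => // p b _ _; rewrite -cats1.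
move=> /is_walk_cat[x [_ /=]] /andP[_ /eqP <-].
by rewrite -catA; apply: shom_catl; exact: shom_iotar.
Qed.

Lemma shom_iota_cat a o p : p != [::] -> is_walk a o p ->
  shom (iota1 a :: p) p.
Proof.
case: p => // b p _ /= /andP[/eqP <- _].
exact: (shom_catr p (shom_iotal b)).
Qed.

Lemma shom_mulVp a o p : p != [::] -> is_walk a o p ->
  shom (p ++ map rev1 (rev p)) [:: iota1 a].
Proof.
elim: p a => // b p IH a _ /= /andP[/eqP <- pw].
rewrite rev_cons map_rcons -cats1.
have [->|p0] := eqVneq p [::]; first exact: shom_rev.
apply: (rst_trans _ _ _ [:: b; iota1 ('d_[0] b); rev1 b]).
  rewrite catA; exact: (shom_catl [:: b] (shom_catr _ (IH _ p0 pw))).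
apply: rst_trans (shom_rev b).
exact: (shom_catr [:: rev1 b] (shom_iotar b)).
Qed.

Definition homotopicb a o : rel (poset_path a o) :=
  fun u v => `[< homotopic u v >].

Lemma homotopicb_equiv a o : equiv_class_of (@homotopicb a o).
Proof.
split=> [p|p q|q p r].
- by apply/asboolP; exact: rst_refl.
- by apply/asboolP/asboolP; exact: rst_sym.
- by move=> /asboolP pq /asboolP qr; apply/asboolP; exact: rst_trans pq qr.
Qed.

Canonical homotopy a o := EquivRelPack (homotopicb_equiv a o).

Definition pi1 a : Type := {eq_quot (homotopy a a)}.

HB.instance Definition _ a := Choice.on (pi1 a).
HB.instance Definition _ a := EqQuotient.on (pi1 a).

Definition homotopy_class a (p : poset_path a a) : pi1 a := \pi p.

Lemma homotopy_classP a (p q : poset_path a a) :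
  homotopy_class p = homotopy_class q <-> homotopic p q.
Proof. by split=> [/eqmodP/asboolP|h]; last exact/eqmodP/asboolP. Qed.

Definition pi1_mul a (l m : pi1 a) : pi1 a :=
  homotopy_class (path_mul (repr l) (repr m)).
Definition pi1_one a : pi1 a := homotopy_class (path_one a).
Definition pi1_inv a (l : pi1 a) : pi1 a := homotopy_class (path_inv (repr l)).

Lemma homotopy_class_repr a (l : pi1 a) : homotopy_class (repr l) = l.
Proof. exact: reprK. Qed.

Lemma shom_repr a (p : poset_path a a) :
  shom (val (repr (homotopy_class p))) (val p).
Proof. by apply/homotopicP/homotopy_classP; rewrite homotopy_class_repr. Qed.

Lemma pi1_mulE a (p q : poset_path a a) :
  pi1_mul (homotopy_class p) (homotopy_class q)
  = homotopy_class (path_mul p q).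
Proof.
apply/homotopy_classP/homotopicP => /=.
apply: rst_trans (shom_catl _ (shom_repr p)).
exact: shom_catr (shom_repr q).
Qed.

Lemma pi1_mulA a : associative (@pi1_mul a).
Proof.
move=> l m n.
rewrite -(homotopy_class_repr l) -(homotopy_class_repr m).
rewrite -(homotopy_class_repr n) !pi1_mulE; congr homotopy_class.
by apply: val_inj; rewrite /= catA.
Qed.

Lemma pi1_mul1 a : left_id (pi1_one a) (@pi1_mul a).
Proof.
move=> l; rewrite -(homotopy_class_repr l) pi1_mulE.
apply/homotopy_classP/homotopicP => /=.
by case: (repr l) => p /= /andP[p0 pw]; exact: shom_cat_iota pw.
Qed.

Lemma pi1_1mul a : right_id (pi1_one a) (@pi1_mul a).
Proof.
move=> l; rewrite -(homotopy_class_repr l) pi1_mulE.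
apply/homotopy_classP/homotopicP => /=.
by case: (repr l) => p /= /andP[p0 pw]; exact: shom_iota_cat pw.
Qed.

Lemma pi1_mulV a : left_inverse (pi1_one a) (@pi1_inv a) (@pi1_mul a).
Proof.
move=> l; rewrite -{2}(homotopy_class_repr l) pi1_mulE.
apply/homotopy_classP/homotopicP => /=.
by case: (repr l) => p /= /andP[p0 pw]; exact: shom_mulVp pw.
Qed.

Lemma pi1_Vmul a : right_inverse (pi1_one a) (@pi1_inv a) (@pi1_mul a).
Proof.
move=> l; rewrite -{1}(homotopy_class_repr l) pi1_mulE.
apply/homotopy_classP/homotopicP => /=.
have /andP[r0 rw] := valP (path_inv (repr l)).
by have := shom_mulVp r0 rw; rewrite /= -map_rev revK (mapK rev1K).
Qed.

HB.instance Definition _ a := isGroup.Build (pi1 a)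
  (@pi1_mulA a) (@pi1_mul1 a) (@pi1_1mul a) (@pi1_mulV a) (@pi1_Vmul a).

HB.instance Definition _ a :=
  DiscreteTopology.copy (pi1 a) (discrete_topology (pi1 a)).

Lemma pi1_mul_continuous a :
  continuous (fun x : pi1 a * pi1 a => (x.1 * x.2)%g : pi1 a).
Proof.
move=> [l m]; apply/discrete_cvg; exists ([set l], [set m]) => /=.
  by split; exact: discrete_set1.
by move=> [l' m'] /= [-> ->].
Qed.

Lemma pi1_inv_continuous a : continuous (fun x : pi1 a => x^-1%g : pi1 a).
Proof.
move=> l; apply/discrete_cvg.
apply: (@filterS _ (nbhs l) _ [set l]); last exact: discrete_set1.
by move=> l' ->.
Qed.

HB.instance Definition _ a := isTopologicalGroup.Build (pi1 a)
  (@pi1_mul_continuous a) (@pi1_inv_continuous a).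

End Homotopy.

Arguments connected_poset {disp} D.

Record two_group (G : topGroupType) := TwoGroup {
  tgN : groupType;
  tg_i : {multiplicative G -> tgN};
  tg_hat : tgN -> {multiplicative G -> G};
  tg_hat_bij : forall u, bijective (tg_hat u);
  tg_hatM : forall (u v : tgN) (g : G),
    tg_hat (u * v)%g g = tg_hat u (tg_hat v g);
  tg_i_hat : forall (u : tgN) (g : G),
    tg_i (tg_hat u g) = (u * tg_i g * u^-1)%g;
  tg_hat_i : forall g h : G, tg_hat (tg_i g) h = (g * h * g^-1)%g
}.

Record cocycle2 {disp : Order.disp_t} (D : porderType disp)
    (G : topGroupType) (T : two_group G) := Cocycle2 {
  coc_u : simplex D 1 -> tgN T;
  coc_g : simplex D 2 -> G;
  coc_i : forall c : simplex D 2,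
    tg_i T (coc_g c) =
      (coc_u ('d_[0] c) * coc_u ('d_[2] c) * (coc_u ('d_[1] c))^-1)%g;
  coc_gg : forall e : simplex D 3,
    (coc_g ('d_[0] e) * coc_g ('d_[2] e))%g =
      (tg_hat (coc_u ('d_[0] ('d_[1] e))) (coc_g ('d_[3] e))
       * coc_g ('d_[1] e))%g
}.

Record category := Category {
  obj :> Type;
  hom : obj -> obj -> Type;
  idhom : forall X, hom X X;
  comp : forall X Y Z, hom Y Z -> hom X Y -> hom X Z;
  comp_idl : forall X Y (f : hom X Y), comp (idhom Y) f = f;
  comp_idr : forall X Y (f : hom X Y), comp f (idhom X) = f;
  comp_assoc : forall X Y Z W (h : hom Z W) (g : hom Y Z) (f : hom X Y),
    comp h (comp g f) = comp (comp h g) f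
}.

Record is_functor (C C' : category) (F0 : C -> C')
    (F1 : forall X Y : C, hom X Y -> hom (F0 X) (F0 Y)) : Prop := IsFunctor {
  functor_id : forall X : C, F1 X X (idhom X) = idhom (F0 X);
  functor_comp : forall (X Y Z : C) (g : hom Y Z) (f : hom X Y),
    F1 X Z (comp g f) = comp (F1 Y Z g) (F1 X Y f)
}.

Section Gerbes.
Context (R : realType) {disp : Order.disp_t} (D : porderType disp).
Variable G : topGroupType.

(* [gb_j ow], for [ow : o <= w], is the isomorphism attached to the element
   [nerve1 ow] of [N1], which runs from [o] to [w]. *)
Record gerbe := Gerbe {
  gb_tg : two_group G;
  gb_q : cocycle2 D gb_tg;
  gb_alg :> D -> cstarAlgType R;
  gb_act : forall o, action G (gb_alg o);
  gb_j : forall o w, (o <= w)%O -> star_iso (gb_alg o) (gb_alg w);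
  gb_j_cocycle : forall o w x (ow : (o <= w)%O) (wx : (w <= x)%O)
      (y : gb_alg o),
    gb_act x (coc_g gb_q (nerve2 ow wx)) (gb_j (le_trans ow wx) y)
    = gb_j wx (gb_j ow y);
  gb_j_act : forall o w (ow : (o <= w)%O) (g : G) (y : gb_alg o),
    gb_j ow (gb_act o g y)
    = gb_act w (tg_hat (coc_u gb_q (nerve1 ow)) g) (gb_j ow y)
}.

(* On [N1] this need not agree with [gb_j], since [gb_j (lexx o)] need not be
   the identity. *)
Definition gerbe_j (A : gerbe) (b : simplex D 1) :
    star_iso (A ('d_[1] b)) (A ('d_[0] b)) :=
  iso_comp (iso_sym (gb_j A (@supp_face1 _ _ b 0 isT)))
    (gb_j A (@supp_face1 _ _ b 1 isT)).

Definition cast_iso (A : gerbe) (o w : D) (e : o = w) : star_iso (A o) (A w) :=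
  match e with erefl => iso_id (A o) end.

(* The casts identify the algebras of equal, but not convertible, points. *)
Fixpoint walk_j (A : gerbe) (a o : D) (p : seq (simplex D 1)) :
    is_walk a o p -> star_iso (A a) (A o) :=
  match p with
  | [::] => fun h => cast_iso A (eqP h)
  | b :: p' => fun h => iso_comp (walk_j A (proj2 (andP h)))
      (iso_comp (gerbe_j A b) (cast_iso A (esym (eqP (proj1 (andP h))))))
  end.

Definition path_j (A : gerbe) (a o : D) (p : poset_path a o) :
    star_iso (A a) (A o) :=
  walk_j A (proj2 (andP (valP p))).

Record gerbe_hom (A A' : gerbe) := GerbeHom {
  gh_fun :> forall o, star_hom (A o) (A' o);
  gh_j : forall o w (ow : (o <= w)%O) (y : A o),
    gh_fun w (gb_j A ow y) = gb_j A' ow (gh_fun o y);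
  gh_act : forall o (g : G) (y : A o),
    gb_act A' o g (gh_fun o y) = gh_fun o (gb_act A o g y)
}.

Lemma gerbe_hom_ext (A A' : gerbe) (f g : gerbe_hom A A') :
  (forall o, f o =1 g o) -> f = g.
Proof.
case: f g => [f f1 f2] [g g1 g2] /= fg.
have e : f = g by apply: functional_extensionality_dep => o; exact: star_hom_ext.
by subst g; congr GerbeHom; exact: Prop_irrelevance.
Qed.

Definition gerbe_id (A : gerbe) : gerbe_hom A A :=
  @GerbeHom A A (fun o => star_id (A o)) (fun _ _ _ _ => erefl)
    (fun _ _ _ => erefl).

Program Definition gerbe_comp (A B C : gerbe) (g : gerbe_hom B C)
  (f : gerbe_hom A B) : gerbe_hom A C :=
  @GerbeHom A C (fun o => star_comp (g o) (f o)) _ _.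
Next Obligation. by move=> A B C g f o w ow y /=; rewrite !gh_j. Qed.
Next Obligation. by move=> A B C g f o h y /=; rewrite !gh_act. Qed.

Definition gerbe_category : category.
Proof.
refine (@Category gerbe gerbe_hom gerbe_id gerbe_comp _ _ _).
- by move=> X Y f; exact: gerbe_hom_ext.
- by move=> X Y f; exact: gerbe_hom_ext.
- by move=> X Y Z W h g f; exact: gerbe_hom_ext.
Defined.

End Gerbes.

Section TwistedSystems.
Variables (R : realType) (P G : topGroupType).

(* [normalizer alpha] carries the topology induced from [Aut A]. *)
Record is_twisted_system (A : cstarAlgType R) (alpha : action G A)
    (nu : P -> normalizer alpha) (gamma : P * P -> G) : Prop :=
  IsTwistedSystem {
    tw_nu_borel : borel_map nu;
    tw_gamma_borel : borel_map gamma;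
    tw_nu1 : set_val (nu 1%g) =1 id;
    tw_nuM : forall l m (x : A),
      set_val (nu l) (set_val (nu m) x)
      = alpha (gamma (l, m)) (set_val (nu (l * m)%g) x)
  }.

Record twisted_system := TwistedSystem {
  ts_alg : cstarAlgType R;
  ts_act : action G ts_alg;
  ts_nu : P -> normalizer ts_act;
  ts_gamma : P * P -> G;
  ts_axioms : is_twisted_system ts_nu ts_gamma
}.

Record is_twisted_hom (X Y : twisted_system)
    (eta : star_hom (ts_alg X) (ts_alg Y)) : Prop := IsTwistedHom {
  twh_nu : forall l (x : ts_alg X),
    eta (set_val (ts_nu X l) x) = set_val (ts_nu Y l) (eta x);
  twh_act : forall g (x : ts_alg X),
    eta (ts_act X g x) = ts_act Y g (eta x)
}.

Record twisted_hom (X Y : twisted_system) := TwistedHom {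
  th_fun :> star_hom (ts_alg X) (ts_alg Y);
  th_axioms : is_twisted_hom th_fun
}.

Lemma twisted_hom_ext (X Y : twisted_system) (f g : twisted_hom X Y) :
  f =1 g -> f = g.
Proof.
case: f g => [f f1] [g g1] /= /star_hom_ext e.
by subst g; congr TwistedHom; exact: Prop_irrelevance.
Qed.

Program Definition twisted_id (X : twisted_system) : twisted_hom X X :=
  @TwistedHom X X (star_id (ts_alg X)) _.
Next Obligation. by move=> X; split. Qed.

Program Definition twisted_comp (X Y Z : twisted_system)
  (g : twisted_hom Y Z) (f : twisted_hom X Y) : twisted_hom X Z :=
  @TwistedHom X Z (star_comp g f) _.
Next Obligation.
move=> X Y Z [g [g1 g2]] [f [f1 f2]]; split=> l x /=.
  by rewrite f1 g1.
by rewrite f2 g2.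
Qed.

Definition twisted_category : category.
Proof.
refine (@Category twisted_system twisted_hom twisted_id twisted_comp _ _ _).
- by move=> X Y f; exact: twisted_hom_ext.
- by move=> X Y f; exact: twisted_hom_ext.
- by move=> X Y Z W h g f; exact: twisted_hom_ext.
Defined.

End TwistedSystems.

Section Holonomy.
Context {R : realType} {disp : Order.disp_t} {D : porderType disp}.
Context {G : topGroupType} {a : D}.
Variable s : pi1 a -> poset_path a a.

Definition holonomy (A : gerbe R D G) (l : pi1 a) : Aut (A a) :=
  path_j A (s l).

Definition holonomy_defect (A : gerbe R D G) (l m : pi1 a) : Aut (A a) :=
  iso_comp (iso_comp (holonomy A l) (holonomy A m))
    (iso_sym (holonomy A (l * m)%g)).

Definition hol_nu (A : gerbe R D G)
    (h : forall l, normalizer (gb_act A a) (holonomy A l)) :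
    pi1 a -> normalizer (gb_act A a) :=
  fun l => SigSub (mem_set (h l)).

Definition hol_gamma (A : gerbe R D G) (sigma : range (gb_act A a) -> G)
    (h : forall l m, range (gb_act A a) (holonomy_defect A l m)) :
    pi1 a * pi1 a -> G :=
  fun lm => sigma (SigSub (mem_set (h lm.1 lm.2))).

End Holonomy.

(* Main.v *)
(* Call two isomorphisms over [o] inner equivalent when they differ by some
   [alpha_o(g)]. Every [j_b] intertwines the actions up to a bijection of [G],
   so inner equivalence is a congruence on composites and inverses of the
   [j_b]. The cocycle identity gives, for every [w] above [|b|], that [j_b] is
   inner equivalent to [j_{w d0 b}^-1 \o j_{w d1 b}]; for the three faces of a
   2-simplex [c] and [w = |c|] these expressions telescope, so homotopic paths
   have inner equivalent transports. Measurability is automatic, as [Pi] and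
   [Pi * Pi] are discrete. *)

Require Import Defs.
From HB Require Import structures.
From mathcomp Require Import all_boot all_order all_algebra.
From mathcomp Require Import generic_quotient.
From mathcomp Require Import all_classical all_reals all_analysis.

Set Implicit Arguments.
Unset Strict Implicit.
Unset Printing Implicit Defensive.

Import Order.TTheory.

Local Open Scope classical_set_scope.

(** * Isomorphisms modulo inner factors *)

Section Actions.
Variables (R : realType) (G : topGroupType).
Implicit Types A B C : cstarAlgType R.

Lemma iso_inj A B (f : star_iso A B) : injective f.
Proof. exact: can_inj (@isoK _ _ _ f). Qed.

(** An [action] is only assumed multiplicative; the unit law follows by cancelling the injective
    [alpha 1]. *)
Lemma act1 A (alpha : action G A) x : alpha 1%g x = x.
Proof. by apply: (@iso_inj _ _ (alpha 1%g)); rewrite -actM mulg1. Qed.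

Lemma actK A (alpha : action G A) g : cancel (alpha g) (alpha g^-1%g).
Proof. by move=> x; rewrite -actM mulVg act1. Qed.

(** The twist [phi] is existential, so composites and inverses need no explicit formula. Its
    bijectivity yields inverses, and equality rather than inclusion for the normalizer. *)
Definition equivariant A B (alpha : action G A) (beta : action G B)
    (f : star_iso A B) : Prop :=
  exists2 phi : G -> G, bijective phi &
    forall g x, f (alpha g x) = beta (phi g) (f x).

Lemma equivariant_id A (alpha : action G A) :
  equivariant alpha alpha (iso_id A).
Proof. by exists id => //; exists id. Qed.

Lemma equivariant_comp A B C (alpha : action G A) (beta : action G B)
    (gamma : action G C) (f' : star_iso B C) (f : star_iso A B) :
  equivariant beta gamma f' -> equivariant alpha beta f ->
  equivariant alpha gamma (iso_comp f' f).
Proof.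
move=> [phi' phi'B f'E] [phi phiB fE]; exists (phi' \o phi).
  exact: bij_comp.
by move=> g x /=; rewrite fE f'E.
Qed.

Lemma equivariant_sym A B (alpha : action G A) (beta : action G B)
    (f : star_iso A B) :
  equivariant alpha beta f -> equivariant beta alpha (iso_sym f).
Proof.
move=> [phi [psi phiK psiK] fE]; exists psi; first by exists phi.
by move=> g x; apply: (@iso_inj _ _ f); rewrite fE /= !isoVK psiK.
Qed.

Lemma equivariant_normalizer A (alpha : action G A) (f : Aut A) :
  equivariant alpha alpha f -> normalizer alpha f.
Proof.
move=> [phi [psi phiK psiK] fE].
have conjE g : iso_comp (iso_comp f (alpha g)) (iso_sym f) = alpha (phi g).
  by apply: star_iso_ext => x /=; rewrite fE isoVK.
apply/seteqP; split=> _ [g _ <-]; first by exists (phi g); rewrite ?conjE.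
by exists (psi g) => //; rewrite conjE psiK.
Qed.

Definition inner_equiv A B (beta : action G B) (f f' : star_iso A B) : Prop :=
  exists g, forall x, f x = beta g (f' x).

Lemma inner_equiv_eq A B (beta : action G B) (f f' : star_iso A B) :
  f =1 f' -> inner_equiv beta f f'.
Proof. by move=> ff'; exists 1%g => x; rewrite act1. Qed.

Lemma inner_equiv_sym A B (beta : action G B) (f f' : star_iso A B) :
  inner_equiv beta f f' -> inner_equiv beta f' f.
Proof. by move=> [g fE]; exists g^-1%g => x; rewrite fE actK. Qed.

Lemma inner_equiv_trans A B (beta : action G B) (f f' f'' : star_iso A B) :
  inner_equiv beta f f' -> inner_equiv beta f' f'' -> inner_equiv beta f f''.
Proof.
by move=> [g fE] [h f'E]; exists (g * h)%g => x; rewrite fE f'E actM.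
Qed.

(** The inner factor of [h1] crosses [f1] at the cost of the twist [phi], then merges with that of
    [f1]. *)
Lemma inner_equiv_comp A B C (beta : action G B) (gamma : action G C)
    (f1 f2 : star_iso B C) (h1 h2 : star_iso A B) :
  equivariant beta gamma f1 -> inner_equiv gamma f1 f2 ->
  inner_equiv beta h1 h2 ->
  inner_equiv gamma (iso_comp f1 h1) (iso_comp f2 h2).
Proof.
move=> [phi _ f1E] [g f12] [k h12]; exists (phi k * g)%g => x /=.
by rewrite h12 f1E f12 actM.
Qed.

Lemma inner_equiv_inv A B (alpha : action G A) (beta : action G B)
    (f1 f2 : star_iso A B) :
  equivariant alpha beta f2 -> inner_equiv beta f1 f2 ->
  inner_equiv alpha (iso_sym f1) (iso_sym f2).
Proof.
(* Inverting [f1 = beta g \o f2] puts [beta g^-1] to the right of the inverse of [f2]; moving it to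
   the left applies [psi]. *)
move=> [phi [psi phiK psiK] f2E] [g f12]; exists (psi g^-1%g) => x.
apply: (@iso_inj _ _ f2); rewrite f2E psiK /= !isoVK.
by rewrite -[in RHS](isoVK f1 x) f12 actK.
Qed.

Lemma inner_equiv_range A (alpha : action G A) (f f' : Aut A) :
  inner_equiv alpha f f' -> range alpha (iso_comp f (iso_sym f')).
Proof.
by move=> [g ff']; exists g => //; apply: star_iso_ext => x /=; rewrite ff' isoVK.
Qed.

End Actions.

(** * Parallel transport along paths *)

Section Transport.
Variables (R : realType) (disp : Order.disp_t) (D : porderType disp).
Variables (G : topGroupType) (A : gerbe R D G).

Lemma gb_j_equivariant o w (ow : (o <= w)%O) :
  equivariant (gb_act A o) (gb_act A w) (gb_j A ow).
Proof.
exists (tg_hat (coc_u (gb_q A) (nerve1 ow))); first exact: tg_hat_bij.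
exact: gb_j_act.
Qed.

Lemma gb_j_comp o w x (ow : (o <= w)%O) (wx : (w <= x)%O) (ox : (o <= x)%O) :
  inner_equiv (gb_act A x) (iso_comp (gb_j A wx) (gb_j A ow)) (gb_j A ox).
Proof.
exists (coc_g (gb_q A) (nerve2 ow wx)) => y /=.
by rewrite -gb_j_cocycle (bool_irrelevance (le_trans ow wx) ox).
Qed.

Lemma cast_iso_id o (e : o = o) : cast_iso A e = iso_id (A o).
Proof. by rewrite (Prop_irrelevance e erefl). Qed.

Lemma cast_iso_equivariant o w (e : o = w) :
  equivariant (gb_act A o) (gb_act A w) (cast_iso A e).
Proof. by case: w / e; exact: equivariant_id. Qed.

Lemma gerbe_j_equivariant b :
  equivariant (gb_act A _) (gb_act A _) (gerbe_j A b).
Proof.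
apply: equivariant_comp (gb_j_equivariant _).
exact/equivariant_sym/gb_j_equivariant.
Qed.

Lemma walk_j_equivariant a o p (h : is_walk a o p) :
  equivariant (gb_act A a) (gb_act A o) (walk_j A h).
Proof.
elim: p a h => [|b p IH] a h /=; first exact: cast_iso_equivariant.
apply: equivariant_comp (IH _ _) _.
exact: equivariant_comp (gerbe_j_equivariant b) (cast_iso_equivariant _).
Qed.

(** Raising the apex from [w] to [v] inserts [gb_j A wv] and its inverse; each leg is then compared
    with the direct map by [gb_j_comp]. *)
Lemma span_comp x y w v (xw : (x <= w)%O) (yw : (y <= w)%O) (wv : (w <= v)%O)
    (xv : (x <= v)%O) (yv : (y <= v)%O) :
  inner_equiv (gb_act A y) (iso_comp (iso_sym (gb_j A yw)) (gb_j A xw))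
    (iso_comp (iso_sym (gb_j A yv)) (gb_j A xv)).
Proof.
apply: (@inner_equiv_trans _ _ _ _ _ _
  (iso_comp (iso_sym (iso_comp (gb_j A wv) (gb_j A yw)))
    (iso_comp (gb_j A wv) (gb_j A xw)))).
  by apply: inner_equiv_eq => z /=; rewrite isoK.
apply: inner_equiv_comp (gb_j_comp _ _ _).
  apply: equivariant_sym; apply: equivariant_comp; exact: gb_j_equivariant.
apply: inner_equiv_inv (gb_j_comp _ _ _); exact: gb_j_equivariant.
Qed.

Lemma walk_j_irr a o p (h h' : is_walk a o p) : walk_j A h = walk_j A h'.
Proof. by rewrite (bool_irrelevance h h'). Qed.

(** Used with [w] the support of a 2-simplex, a common apex for its three edges. The start [a] stays
    a variable, so the right-hand side carries no cast for the first edge. *)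
Lemma walk_j_cons a o b p w (h : is_walk a o (b :: p))
    (h' : is_walk ('d_[0] b) o p) (bw : (supp b <= w)%O)
    (aw : (a <= w)%O) (b0w : ('d_[0] b <= w)%O) :
  inner_equiv (gb_act A o) (walk_j A h)
    (iso_comp (walk_j A h') (iso_comp (iso_sym (gb_j A b0w)) (gb_j A aw))).
Proof.
rewrite [walk_j A h]/= (walk_j_irr _ h').
apply: inner_equiv_comp; first exact: walk_j_equivariant.
  exact: inner_equiv_eq.
(* Only [a] is a variable, so the equation is reversed in order to replace [a] by the source of [b];
   the cast then becomes the identity. *)
move: (esym _) => e; have ea := esym e; case: a / ea {h} e aw => e aw.
apply: inner_equiv_trans (span_comp (supp_face1 b _) (supp_face1 b _) bw _ _).
by apply: inner_equiv_eq => x; rewrite cast_iso_id.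
Qed.

Lemma walk_j_deformation a o p p' (pp' : deformation p p')
    (h : is_walk a o p) (h' : is_walk a o p') :
  inner_equiv (gb_act A o) (walk_j A h) (walk_j A h').
Proof.
case: {p p'} pp' h h' => p c q; elim: p a => [|b p IH] a h h'; last first.
  (* A shared leading edge contributes the same factor, up to the equality proof inside the cast. *)
  rewrite /=; apply: inner_equiv_comp; first exact: walk_j_equivariant.
    exact: IH.
  apply: inner_equiv_eq => x /=; do 3 congr (_ _); congr cast_iso.
  exact: Prop_irrelevance.
rewrite !cat0s in h h' *.
have leS k (k3 : (k < 3)%N) : (supp (face c k3) <= supp c)%O.
  exact: supp_face.
have leV k j (k3 : (k < 3)%N) (j2 : (j < 2)%N) :
    (face (face c k3) j2 <= supp c)%O.
  exact: le_trans (supp_face1 _ _) (leS _ _).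
have [/eqP ea hq] := andP h; have [_ h'q] := andP h'; have [_ h''q] := andP h'q.
have aw : (a <= supp c)%O by rewrite -ea; exact: leV.
have b0w : ('d_[0] ('d_[1] c) <= supp c)%O := leV _ _ _ _.
have b0w' : ('d_[0] ('d_[0] c) <= supp c)%O := leV _ _ _ _.
have b2w : ('d_[0] ('d_[2] c) <= supp c)%O := leV _ _ _ _.
apply: inner_equiv_trans (walk_j_cons h hq (leS _ _) aw b0w) _.
apply: inner_equiv_sym.
apply: inner_equiv_trans (walk_j_cons h' h'q (leS _ _) aw b2w) _.
(* The second edge is expanded over the same apex, so that the two legs at the middle vertex become
   mutually inverse. *)
apply: (@inner_equiv_trans _ _ _ _ _ _ (iso_comp (iso_comp (walk_j A h''q)
  (iso_comp (iso_sym (gb_j A b0w')) (gb_j A b2w)))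
    (iso_comp (iso_sym (gb_j A b2w)) (gb_j A aw)))).
  apply: inner_equiv_comp; first exact: walk_j_equivariant.
    exact: walk_j_cons (leS _ _) _ _.
  exact: inner_equiv_eq.
apply: inner_equiv_eq => x /=; rewrite isoVK.
(* The end vertices agree only through [face00]; once they are identified, the sides differ just by
   proofs. *)
case: _ / (face00 c) {h h' h'q} hq h''q b0w b0w' => hq h''q b0w b0w'.
by rewrite (walk_j_irr hq h''q) (bool_irrelevance b0w b0w').
Qed.

Lemma path_j_homotopic a o (p q : poset_path a o) :
  homotopic p q -> inner_equiv (gb_act A o) (path_j A p) (path_j A q).
Proof.
elim=> {p q} [p q pq|p|p q _|p q r _ + _].
- exact: walk_j_deformation.
- exact: inner_equiv_eq.
- exact: inner_equiv_sym.
- exact: inner_equiv_trans.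
Qed.

Lemma walk_j_cat a x o p q (h : is_walk a o (p ++ q)) (hp : is_walk a x p)
    (hq : is_walk x o q) : walk_j A h =1 walk_j A hq \o walk_j A hp.
Proof.
elim: p a h hp => [|b p IH] a h hp y /=.
  move: (eqP hp) => {hp} e; case: x / e hq => hq /=.
  by rewrite (walk_j_irr h hq).
rewrite (IH _ _ (proj2 (andP hp))) /=.
by rewrite (Prop_irrelevance (esym (eqP (proj1 (andP h))))
  (esym (eqP (proj1 (andP hp))))).
Qed.

Lemma path_j_mul a x o (q : poset_path x o) (p : poset_path a x) :
  path_j A (path_mul q p) =1 path_j A q \o path_j A p.
Proof. exact: walk_j_cat. Qed.

(** Both legs of [iota1 a] are [gb_j] at [a <= a], so they cancel exactly even if that map is not
    the identity. *)
Lemma path_j_one a : path_j A (path_one a) =1 id.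
Proof.
move=> x; rewrite /path_j /= !cast_iso_id /=.
have jE (h h' : (a <= a)%O) : iso_inv (gb_j A h) (gb_j A h' x) = x.
  by rewrite (bool_irrelevance h h') isoK.
exact: jE.
Qed.

End Transport.

(** * Naturality of transport *)

Section Morphisms.
Variables (R : realType) (disp : Order.disp_t) (D : porderType disp).
Variables (G : topGroupType) (A A' : gerbe R D G) (eta : gerbe_hom A A').

Lemma gerbe_hom_cast o w (e : o = w) y :
  eta w (cast_iso A e y) = cast_iso A' e (eta o y).
Proof. by case: w / e. Qed.

(** Compatibility is given for [gb_j] alone; applying the injective leg at face 0 removes the
    inverse. *)
Lemma gerbe_hom_j (b : simplex D 1) y :
  eta ('d_[0] b) (gerbe_j A b y) = gerbe_j A' b (eta ('d_[1] b) y).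
Proof.
apply: (@iso_inj _ _ _ (gb_j A' (@supp_face1 _ _ b 0 isT))).
by rewrite -gh_j /= !isoVK gh_j.
Qed.

Lemma gerbe_hom_walk a o p (h : is_walk a o p) y :
  eta o (walk_j A h y) = walk_j A' h (eta a y).
Proof.
elim: p a h y => [|b p IH] a h y /=; first exact: gerbe_hom_cast.
rewrite IH -gerbe_hom_cast; congr (_ _); exact: gerbe_hom_j.
Qed.

End Morphisms.

(** All subsets of [X] are open, so every preimage is Borel. *)
Lemma discrete_borel_map (X Y : topologicalType) (f : X -> Y) :
  (forall x : X, nbhs x [set x]) -> borel_map f.
Proof.
move=> dX B _; apply: sub_sigma_algebra; rewrite /= openE => x fx.
by apply: filterS (dX x) => _ ->.
Qed.

(** * Twisted holonomy and functoriality *)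

Section Holonomy.
Variables (R : realType) (disp : Order.disp_t) (D : porderType disp).
Variables (G : topGroupType) (a : D) (s : pi1 a -> poset_path a a).
Variable A : gerbe R D G.

Lemma holonomy_normalizer l : normalizer (gb_act A a) (holonomy s A l).
Proof. exact/equivariant_normalizer/walk_j_equivariant. Qed.

(** Transport is strictly multiplicative on concatenated loops; the defect only compares the product
    of [s l] and [s m] with the homotopic loop [s (l * m)]. *)
Lemma holonomy_defect_range (sK : forall l, homotopy_class (s l) = l) l m :
  range (gb_act A a) (holonomy_defect s A l m).
Proof.
apply: inner_equiv_range.
apply: (@inner_equiv_trans _ _ _ _ _ _ (path_j A (path_mul (s l) (s m)))).
  by apply: inner_equiv_eq => x; rewrite path_j_mul.
apply/path_j_homotopic/homotopy_classP.
by rewrite -pi1_mulE !sK.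
Qed.

End Holonomy.

Theorem theorem4p19 (R : realType) (disp : Order.disp_t)
    (D : porderType disp) (G : topGroupType) (a : D)
    (connD : connected_poset D)
    (countPi : countable [set: pi1 a])
    (lcG : locally_compact [set: G])
    (s : pi1 a -> poset_path a a)
    (sK : forall l, homotopy_class (s l) = l)
    (s1 : s 1%g = path_one a)
    (sigma : forall A : gerbe R D G, range (gb_act A a) -> G)
    (sigmaK : forall (A : gerbe R D G) (f : range (gb_act A a)),
      gb_act A a (sigma A f) = set_val f) :
  exists (h_nu : forall (A : gerbe R D G) l,
            normalizer (gb_act A a) (holonomy s A l))
         (h_gamma : forall (A : gerbe R D G) l m,
            range (gb_act A a) (holonomy_defect s A l m))
         (h_sys : forall A : gerbe R D G,
            is_twisted_system (hol_nu (h_nu A))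
              (hol_gamma (sigma A) (h_gamma A))),
  let Aast (A : gerbe R D G) : twisted_system R (pi1 a) G :=
    TwistedSystem (h_sys A) in
  exists h_hom : forall (A A' : gerbe R D G) (eta : gerbe_hom A A'),
           @is_twisted_hom _ _ _ (Aast A) (Aast A') (eta a),
  @is_functor (gerbe_category R D G) (twisted_category R (pi1 a) G)
    Aast (fun A A' eta => TwistedHom (h_hom A A' eta)).
Proof.
exists (holonomy_normalizer s), (fun A => holonomy_defect_range A sK).
have h_sys A : is_twisted_system (hol_nu (holonomy_normalizer s A))
    (hol_gamma (sigma A) (holonomy_defect_range A sK)).
  split=> [|||l m x].
  - by apply: discrete_borel_map => l; exact: discrete_set1.
  - apply: discrete_borel_map => -[l m].
    exists ([set l], [set m]) => [|[l' m'] /= [-> ->] //].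
    by split; exact: discrete_set1.
  (* The normalization of [s] makes the unit law strict. *)
  - by move=> x; rewrite -[RHS](path_j_one x) -s1.
  (* Since [sigma] is a section, the action of [gamma] is the defect, whose last factor cancels the
     holonomy of [l * m]. *)
  - by rewrite /hol_gamma sigmaK /= isoK.
exists h_sys => Aast.
have h_hom A A' (eta : gerbe_hom A A') :
    @is_twisted_hom _ _ _ (Aast A) (Aast A') (eta a).
  by split=> [l x|g x] /=; [exact: gerbe_hom_walk|rewrite gh_act].
exists h_hom; split=> *; exact: twisted_hom_ext.
Qed.
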